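(* Let $Q$ be a valued cluster quiver with $|Q_0|=n$ and let $Q'$ be a full valued subquiver of $Q$ with $n-1$ vertices. If the eigenvalues of $B(Q)$ (counted with multiplicity) are $\lambda_1\mathrm{i},\lambda_2\mathrm{i},\dots,\lambda_n\mathrm{i}$ with $\lambda_1\ge\lambda_2\ge\dots\ge\lambda_n$ real, and the eigenvalues of $B(Q')$ (counted with multiplicity) are $\gamma_2\mathrm{i},\gamma_3\mathrm{i},\dots,\gamma_n\mathrm{i}$ with $\gamma_2\ge\gamma_3\ge\dots\ge\gamma_n$ real, where $\mathrm{i}=\sqrt{-1}$, then $$\lambda_1\ge\gamma_2\ge\lambda_2\ge\gamma_3\ge\lambda_3\ge\dots\ge\gamma_n\ge\lambda_n.$$
   Context: A valued cluster quiver $(Q,v)$ (written $Q$) is a finite quiver (oriented graph with vertex set $Q_0=\{1,\dots,n\}$ and arrow set $Q_1$) without loops and with at most one arrow between any pair of vertices (so in particular no oriented 2-cycles), together with a map $v:Q_1\to\mathbb{Z}_{>0}^2$, $v(\alpha)=(v(\alpha)_1,v(\alpha)_2)$, for which there is a map $d:Q_0\to\mathbb{Z}_{>0}$ such that $d(i)v(\alpha)_1=d(j)v(\alpha)_2$ for each arrow $\alpha:i\to j$. For an arrow $\alpha:i\to j$ write $v_{ij}=v(\alpha)_1$, $v_{ji}=v(\alpha)_2$. The exchange matrix $B(Q)=(b_{ij})_{n\times n}$ is defined by $b_{ij}=v_{ij}$ if there is an arrow $i\to j$, $b_{ij}=-v_{ij}$ if there is an arrow $j\to i$, and $b_{ij}=0$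 otherwise. There is a diagonal matrix $D$ with positive integer diagonal entries such that $DB(Q)$ is skew-symmetric, so all eigenvalues of $B(Q)$ are purely imaginary or zero. A full valued subquiver of $Q$ is the quiver on a subset of $Q_0$ consisting of all arrows of $Q$ between vertices of the subset, with the restricted valuing map; its exchange matrix is the corresponding principal submatrix of $B(Q)$. *)

(* Defs.v *)
From HB Require Import structures.
From mathcomp Require Import all_boot all_order all_algebra.
From mathcomp Require Import reals complex.
Set Implicit Arguments.
Unset Strict Implicit.
Unset Printing Implicit Defensive.
Import Order.TTheory GRing.Theory Num.Theory.
Local Open Scope ring_scope.

Record valued_cluster_quiver := ValuedClusterQuiver {
  vertex : finType;
  arrow : finType;
  source : arrow -> vertex;
  target : arrow -> vertex;
  val1 : arrow -> nat;
  val2 : arrow -> nat;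
  no_loop : forall a, source a != target a;
  (* At most one arrow per unordered pair, so 2-cycles are excluded too. *)
  simple_arrow : forall a b,
    [set source a; target a] = [set source b; target b] -> a = b;
  val_gt0 : forall a, (0 < val1 a)%N && (0 < val2 a)%N;
  symmetrizable : exists d : vertex -> nat,
    (forall i, (0 < d i)%N) /\
    (forall a, (d (source a) * val1 a)%N = (d (target a) * val2 a)%N)
}.

Definition arrow_between (Q : valued_cluster_quiver) (i j : vertex Q) :
    option (arrow Q) :=
  [pick a | (source a == i) && (target a == j)].

(* An arrow [a : i -> j] has v_ij = val1 a and v_ji = val2 a, so that
   b_ij = val1 a and b_ji = - val2 a.  The vertices are numbered by
   [enum_val]. *)
Definition exchange_entry (Q : valued_cluster_quiver) (i j : vertex Q) : int :=
  if arrow_between i j is Some a then (val1 a)%:Z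
  else if arrow_between j i is Some a then - (val2 a)%:Z
  else 0.

Definition exchange_mx (Q : valued_cluster_quiver) : 'M[int]_#|vertex Q| :=
  \matrix_(i, j) exchange_entry (enum_val i) (enum_val j).

Section FullSubquiver.
Variables (Q : valued_cluster_quiver) (S : {set vertex Q}).

Definition sub_vertex : finType := {i : vertex Q | i \in S}.
Definition sub_arrow : finType :=
  {a : arrow Q | (source a \in S) && (target a \in S)}.

Definition sub_source (a : sub_arrow) : sub_vertex :=
  exist _ (source (val a)) (proj1 (andP (valP a))).
Definition sub_target (a : sub_arrow) : sub_vertex :=
  exist _ (target (val a)) (proj2 (andP (valP a))).

Lemma sub_no_loop a : sub_source a != sub_target a.
Proof. by rewrite -val_eqE /=; apply: no_loop. Qed.

Lemma sub_simple_arrow a b :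
  [set sub_source a; sub_target a] = [set sub_source b; sub_target b] -> a = b.
Proof.
move=> /(congr1 (fun X : {set sub_vertex} => [set val x | x in X])).
rewrite !imsetU !imset_set1 /= => eq_ab.
exact/val_inj/simple_arrow.
Qed.

Lemma sub_symmetrizable : exists d : sub_vertex -> nat,
  (forall i, (0 < d i)%N) /\
  (forall a : sub_arrow, (d (sub_source a) * val1 (val a))%N =
                         (d (sub_target a) * val2 (val a))%N).
Proof.
have [d [d_gt0 dE]] := symmetrizable Q.
by exists (fun i => d (val i)); split=> [i | a] /=; [apply: d_gt0 | apply: dE].
Qed.

Definition full_subquiver : valued_cluster_quiver :=
  @ValuedClusterQuiver sub_vertex sub_arrow sub_source sub_target
    (fun a => val1 (val a)) (fun a => val2 (val a))
    sub_no_loop sub_simple_arrow (fun a => val_gt0 (val a)) sub_symmetrizable.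

End FullSubquiver.

(* The numbers [lambda k * i], for [m <= k <= n], are the eigenvalues of [B]
   listed with algebraic multiplicity. *)
Definition imaginary_eigenvalues (R : realType) (p : nat) (B : 'M[int]_p)
    (m n : nat) (lambda : nat -> R) : Prop :=
  char_poly (map_mx (intr : int -> R[i]) B) =
    \prod_(m <= k < n.+1) ('X - ((lambda k)%:C%C * 'i%C)%:P).

Definition nonincreasing_on (R : realType) (m n : nat) (lambda : nat -> R) :
    Prop :=
  forall j k, (m <= j)%N -> (j <= k)%N -> (k <= n)%N -> lambda k <= lambda j.

(* Main.v *)
Require Import Defs.
From mathcomp Require Import all_boot all_order all_algebra.
From mathcomp Require Import reals complex zify.
Import Order.TTheory GRing.Theory Num.Theory.
Local Open Scope ring_scope.
Local Open Scope sesquilinear_scope.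

(** The proof is the classical Cauchy interlacing argument.

    If positive integers w_i satisfy w_i b_ij = - w_j b_ji, conjugating B by
    the diagonal matrix of the square roots of the w_i gives a real
    skew-symmetric matrix, that is, i times a Hermitian matrix A.  So
    the lambda_k are the eigenvalues of A.  The same weights work for any full
    subquiver, whose exchange matrix is a principal submatrix of B; hence the
    gamma_k are the eigenvalues of the principal submatrix J A J^* of A, where
    J is made of rows of the identity.

    Interlacing is then a dimension count ([diagonalized_compression_le]).
    Let A have size n and J A J^* size m.  Requiring x in C^m to be orthogonal
    to the eigenvectors of J A J^* with eigenvalue less than b, and x J to be
    orthogonal to those of A with eigenvalue greater than a, imposes as many linear
    equations as there are such eigenvalues.  When there are fewer than m of
    them, some x <> 0 satisfies them all, and its common value under the two
    quadratic forms is at least b |x|^2 and at most a |x|^2, so that b <= a.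
    Taking a = lambda_k and b = gamma_(k+1), the listing order bounds the
    number of equations by (k - 1) + (n - k - 1) = n - 2 < m = n - 1.  The other
    inequality is the same statement for - A, obtained by factoring out the
    imaginary unit - i in place of i. *)

(** * Linear algebra *)

Lemma exists_mulmx_eq0 (F : fieldType) m p (M : 'M[F]_(m, p)) :
  (p < m)%N -> exists2 x : 'rV[F]_m, x != 0 & x *m M = 0.
Proof.
move=> lt_pm; have: kermx M != 0.
  rewrite -mxrank_eq0 mxrank_ker subn_eq0 -ltnNge.
  exact: leq_ltn_trans (rank_leq_col M) lt_pm.
move=> /rowV0Pn[x /sub_kermxP xM x_neq0]; by exists x.
Qed.

(** The m coordinates of x satisfy fewer than m homogeneous linear equations,
    one for each selected column of M1 or M2. *)
Lemma exists_row_vanishing (F : fieldType) m n1 n2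
    (M1 : 'M[F]_(m, n1)) (M2 : 'M[F]_(m, n2))
    (I1 : {set 'I_n1}) (I2 : {set 'I_n2}) :
    (#|I1| + #|I2| < m)%N ->
  exists x : 'rV[F]_m, [/\ x != 0,
    {in I1, forall i, (x *m M1) 0 i = 0} &
    {in I2, forall i, (x *m M2) 0 i = 0}].
Proof.
move=> lt_m.
have [x x_neq0] := exists_mulmx_eq0 _ _ _
  (row_mx (colsub (fun j : 'I_#|I1| => enum_val j) M1)
          (colsub (fun j : 'I_#|I2| => enum_val j) M2)) lt_m.
rewrite mul_mx_row !mulmx_colsub -row_mx0 => /eq_row_mx[x1 x2].
exists x; split=> // i iI.
- by move/rowP/(_ (enum_rank_in iI i)): x1; rewrite !mxE enum_rankK_in.
- by move/rowP/(_ (enum_rank_in iI i)): x2; rewrite !mxE enum_rankK_in.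
Qed.

Lemma char_poly_similar (F : fieldType) n (P A : 'M[F]_n) :
  P \in unitmx -> char_poly (invmx P *m A *m P) = char_poly A.
Proof.
move=> P_unit; rewrite /char_poly /char_poly_mx.
pose Q := map_mx (@polyC F) P.
have QV : map_mx (@polyC F) (invmx P) *m Q = 1%:M.
  by rewrite -map_mxM mulVmx // map_mx1.
have -> : 'X%:M - map_mx (@polyC F) (invmx P *m A *m P) =
    map_mx (@polyC F) (invmx P) *m ('X%:M - map_mx (@polyC F) A) *m Q.
  rewrite mulmxBr mulmxBl scalar_mxC -(mulmxA 'X%:M) QV mulmx1.
  by rewrite !map_mxM.
by rewrite !det_mulmx mulrAC -det_mulmx QV det1 mul1r.
Qed.

(** * Interlacing for compressions of Hermitian matrices *)

Section Hermitian.
Variable C : numClosedFieldType.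

Lemma trmxC_mul m n p (A : 'M[C]_(m, n)) (B : 'M[C]_(n, p)) :
  (A *m B)^t* = B^t* *m A^t*.
Proof. by rewrite trmx_mul map_mxM. Qed.

Lemma diag_formE n (d y : 'rV[C]_n) :
  (y *m diag_mx d *m y^t*) 0 0 = \sum_i d 0 i * `|y 0 i| ^+ 2.
Proof.
rewrite mxE; apply: eq_bigr => i _.
by rewrite mul_mx_diag !mxE mulrAC mulrC normCK.
Qed.

Lemma sum_sqr_norm_unitary m n (U : 'M[C]_(m, n)) (x : 'rV[C]_m) :
  U \is unitarymx ->
  \sum_i `|(x *m U) 0 i| ^+ 2 = \sum_i `|x 0 i| ^+ 2.
Proof.
have normE k (y : 'rV[C]_k) : \sum_i `|y 0 i| ^+ 2 = (y *m y^t*) 0 0.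
  by rewrite mxE; apply: eq_bigr => i _; rewrite !mxE normCK.
by move=> U_unit; rewrite !normE trmxC_mul mulmxA mulmxtVK.
Qed.

(** The heart of the interlacing: Rayleigh quotients on a vector common to two
    spans of eigenvectors.  C is only partially ordered, so the eigenvectors to
    avoid are those whose eigenvalue fails the wanted bound; for real
    eigenvalues, those beyond it. *)
Lemma diagonalized_compression_le m n (P : 'M[C]_n) (P' : 'M[C]_m)
    (J : 'M[C]_(m, n)) (d : 'rV[C]_n) (d' : 'rV[C]_m) (a b : C) :
    P \is unitarymx -> P' \is unitarymx -> J \is unitarymx ->
    P'^t* *m diag_mx d' *m P' = J *m (P^t* *m diag_mx d *m P) *m J^t* ->
    (#|[set i | ~~ (d 0 i <= a)%R]| + #|[set i | ~~ (b <= d' 0 i)%R]| < m)%N ->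
  b <= a.
Proof.
move=> P_unit P'_unit J_unit eq_form.
move=> /(exists_row_vanishing _ _ _ _ (J *m P^t*) (P'^t*))[x [x_neq0 x0 x0']].
have N_gt0 : 0 < \sum_i `|x 0 i| ^+ 2.
  have N_ge0 i : 0 <= `|x 0 i| ^+ 2 by rewrite exprn_ge0.
  rewrite lt_neqAle sumr_ge0 // andbT eq_sym; apply: contra x_neq0 => /eqP.
  move=> /psumr_eq0P x_eq0; apply/eqP/rowP=> i; rewrite mxE.
  by apply/eqP; rewrite -normr_eq0 -(sqrf_eq0 `|_|) x_eq0.
(* Both forms take the same value at x, written in the two eigenbases. *)
have formE : \sum_i d' 0 i * `|(x *m P'^t*) 0 i| ^+ 2 =
    \sum_i d 0 i * `|(x *m (J *m P^t*)) 0 i| ^+ 2.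
  rewrite -!diag_formE; congr (fun_of_matrix _ 0 0).
  rewrite !trmxC_mul !trmxCK !mulmxA.
  by have := congr1 (fun X => x *m X *m x^t*) eq_form; rewrite /= !mulmxA.
set N := \sum_i _ in N_gt0; suff: b * N <= a * N by rewrite ler_pM2r.
have JP_unit : J *m P^t* \is unitarymx by rewrite mul_unitarymx ?trmxC_unitary.
rewrite -{1}[N](sum_sqr_norm_unitary _ _ (P'^t*)) ?trmxC_unitary //.
rewrite -[N](sum_sqr_norm_unitary _ _ _ _ JP_unit).
rewrite !mulr_sumr.
apply: (@le_trans _ _ (\sum_i d' 0 i * `|(x *m P'^t*) 0 i| ^+ 2)).
  apply: ler_sum => i _; have [le_b|] := boolP (b <= d' 0 i).
    by rewrite ler_wpM2r ?exprn_ge0.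
  by move=> lt_b; rewrite x0' ?inE // normr0 expr0n !mulr0.
rewrite formE; apply: ler_sum => i _; have [le_a|] := boolP (d 0 i <= a).
  by rewrite ler_wpM2r ?exprn_ge0.
by move=> lt_a; rewrite x0 ?inE // normr0 expr0n !mulr0.
Qed.

(** A factorization of the characteristic polynomial determines the diagonal
    found by the spectral theorem up to permutation, hence what can be counted
    on it.  The scalar c lets the factorization be given for a multiple of A,
    such as the skew-Hermitian matrix i A. *)
Lemma card_spectral_diag n (A : 'M[C]_n) (c : C) (s : seq C) (p : pred C) :
    c != 0 -> A \is hermsymmx ->
    char_poly (c *: A) = \prod_(x <- s) ('X - (c * x)%:P) ->
  #|[set i | p (spectral_diag A 0 i)]| = count p s.
Proof.
move=> c_neq0 A_herm.
have /orthomx_spectralP AE := hermitian_normalmx A_herm.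
set d := spectral_diag A in AE *.
rewrite AE scalemxAl scalemxAr char_poly_similar ?spectral_unit //.
have cdE : c *: diag_mx d = diag_mx (c *: d) by rewrite linearZ.
rewrite cdE char_poly_trig ?diag_mx_is_trig //.
have -> : \prod_(i < n) ('X - (diag_mx (c *: d) i i)%:P) =
    \prod_(x <- [seq c * x | x <- [seq d 0 i | i <- enum 'I_n]]) ('X - x%:P).
  rewrite 2!big_map big_enum; apply: eq_bigr => i _.
  by rewrite !mxE eqxx.
have -> : \prod_(x <- s) ('X - (c * x)%:P) =
    \prod_(x <- [seq c * x | x <- s]) ('X - x%:P) by rewrite big_map.
move=> /prod_XsubC_eq/(perm_map_inj (mulfI c_neq0))/permP/(_ p) <-.
rewrite count_map cardE enumT {1}/enum_mem size_filter.
by apply: eq_count => i; rewrite !inE.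
Qed.

Lemma hermitian_compression_le m n (H : 'M[C]_n) (J : 'M[C]_(m, n)) (c : C)
    (s t : seq C) (a b : C) :
    c != 0 -> H \is hermsymmx -> J \is unitarymx ->
    char_poly (c *: H) = \prod_(x <- s) ('X - (c * x)%:P) ->
    char_poly (c *: (J *m H *m J^t*)) = \prod_(x <- t) ('X - (c * x)%:P) ->
    (count (fun x => ~~ (x <= a)%R) s +
     count (fun x => ~~ (b <= x)%R) t < m)%N ->
  b <= a.
Proof.
move=> c_neq0 H_herm J_unit Hs Ht.
have H'_herm : J *m H *m J^t* \is hermsymmx.
  apply/is_hermitianmxP; rewrite expr0 scale1r !trmxC_mul trmxCK mulmxA.
  by move/is_hermitianmxP: H_herm; rewrite expr0 scale1r => <-.
rewrite -(card_spectral_diag _ _ _ _ _ c_neq0 H_herm Hs).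
rewrite -(card_spectral_diag _ _ _ _ _ c_neq0 H'_herm Ht).
have spectralE k (A : 'M[C]_k) : A \is hermsymmx ->
    A = (spectralmx A)^t* *m diag_mx (spectral_diag A) *m spectralmx A.
  move=> /hermitian_normalmx/orthomx_spectralP.
  by rewrite invmx_unitary ?spectral_unitarymx.
apply: (diagonalized_compression_le _ _ (spectralmx H)
  (spectralmx (J *m H *m J^t*)) J); rewrite ?spectral_unitarymx //.
by rewrite -!spectralE.
Qed.

(** The scalar c is any imaginary number: it turns the symmetrized form of B,
    which is skew-Hermitian, into a Hermitian matrix, and changing its sign
    reverses the order of the eigenvalues.  A submatrix of B is symmetrized by
    the restricted weights, so that one Hermitian matrix serves for both. *)
Lemma skew_symmetrizable_le m n (B : 'M[int]_n) (w : 'I_n -> nat)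
    (f : 'I_m -> 'I_n) (c : C) (s t : seq C) (a b : C) :
    c != 0 -> c^* = - c -> injective f ->
    (forall i, (0 < w i)%N) ->
    (forall i j, (w i)%:Z * B i j = - ((w j)%:Z * B j i)) ->
    char_poly (map_mx intr B) = \prod_(x <- s) ('X - (c * x)%:P) ->
    char_poly (map_mx intr (mxsub f f B)) = \prod_(x <- t) ('X - (c * x)%:P) ->
    (count (fun x => ~~ (x <= a)%R) s +
     count (fun x => ~~ (b <= x)%R) t < m)%N ->
  b <= a.
Proof.
move=> c_neq0 conj_c f_inj w_gt0 skewB.
pose r i : C := sqrtC (w i)%:R.
have r_gt0 i : 0 < r i by rewrite sqrtC_gt0 ltr0n.
have r_neq0 i : r i != 0 by rewrite gt_eqF.
have r_conj i : (r i)^* = r i by rewrite conj_Creal ?ger0_real ?ltW.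
(* Conjugation by W h symmetrizes the submatrix of B with indices h. *)
pose W k (h : 'I_k -> 'I_n) : 'M[C]_k := diag_mx (\row_i (r (h i))^-1).
have W_unit k (h : 'I_k -> 'I_n) : W k h \in unitmx.
  rewrite unitmxE det_diag unitfE; apply/prodf_neq0 => i _.
  by rewrite mxE invr_eq0.
have WV k (h : 'I_k -> 'I_n) : invmx (W k h) = diag_mx (\row_i r (h i)).
  apply: (can_inj (mulmxK (W_unit k h))); rewrite mulVmx // mulmx_diag.
  by apply/matrixP=> i j; rewrite !mxE mulfV.
pose A : 'M[C]_n := \matrix_(i, j) (c^-1 * (r i * (B i j)%:~R / r j)).
pose J : 'M[C]_(m, n) := rowsub f 1%:M.
have WBE k (h : 'I_k -> 'I_n) :
    invmx (W k h) *m map_mx intr (mxsub h h B) *m W k h = c *: mxsub h h A.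
  rewrite WV mul_mx_diag mul_diag_mx; apply/matrixP=> i j; rewrite !mxE.
  by rewrite mulVKf.
have JA : J *m A *m J^t* = mxsub f f A.
  rewrite mul_rowsub_mx mul1mx; apply/matrixP=> i j; rewrite !mxE.
  rewrite (bigD1 (f j)) //= !mxE eqxx conjC1 mulr1 big1 ?addr0 // => k neq_k.
  by rewrite !mxE eq_sym (negPf neq_k) conjC0 mulr0.
have J_unit : J \is unitarymx.
  apply/unitarymxP; apply/matrixP=> i j; rewrite mul_rowsub_mx mul1mx !mxE.
  by rewrite (inj_eq f_inj) rmorph_nat eq_sym.
have A_herm : A \is hermsymmx.
  apply/is_hermitianmxP; rewrite expr0 scale1r; apply/matrixP=> i j.
  rewrite !mxE !rmorphM !fmorphV /= conj_c !r_conj rmorph_int invrN mulNr -mulrN.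
  have sqr_r : r i ^+ 2 * (B i j)%:~R = - (r j ^+ 2 * (B j i)%:~R).
    by rewrite !sqrtCK !pmulrn -!intrM skewB rmorphN.
  congr (_ * _); rewrite -mulNr; apply/eqP; rewrite eqr_div //; apply/eqP.
  by rewrite mulNr !(mulrAC _ _ (r _)) -!expr2.
rewrite -(char_poly_similar _ _ (W n id)) //.
rewrite -(char_poly_similar _ _ (W m f)) //.
rewrite -{1}(mxsub_eq_id (fun _ => erefl) (fun _ => erefl) B).
rewrite !WBE mxsub_eq_id // -JA.
exact: hermitian_compression_le.
Qed.
End Hermitian.

(** * Counting in nonincreasing lists *)

Lemma count_gt_nonincreasing (R : realType) p q (u : nat -> R) k :
    nonincreasing_on p q u -> (p <= k <= q)%N ->
  (count (fun j => ~~ (u j <= u k)%R) (index_iota p q.+1) <= k - p)%N.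
Proof.
move=> u_dec /andP[le_pk le_kq].
rewrite /index_iota (_ : (q.+1 - p = (k - p) + (q.+1 - k))%N); last by lia.
rewrite iotaD count_cat subnKC // -[X in (_ <= X)%N]addn0 leq_add //.
  by rewrite (leq_trans (count_size _ _)) ?size_iota.
rewrite leqn0 eqn0Ngt -has_count; apply/hasPn=> j; rewrite mem_iota => ?.
by rewrite /= negbK u_dec //; lia.
Qed.

Lemma count_lt_nonincreasing (R : realType) p q (u : nat -> R) k :
    nonincreasing_on p q u -> (p <= k <= q)%N ->
  (count (fun j => ~~ (u k <= u j)%R) (index_iota p q.+1) <= q - k)%N.
Proof.
move=> u_dec /andP[le_pk le_kq].
rewrite /index_iota (_ : (q.+1 - p = (k.+1 - p) + (q - k))%N); last by lia.
rewrite iotaD count_cat -[X in (_ <= X)%N]add0n leq_add //; last first.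
  by rewrite (leq_trans (count_size _ _)) ?size_iota.
rewrite leqn0 eqn0Ngt -has_count; apply/hasPn=> j; rewrite mem_iota => ?.
by rewrite /= negbK u_dec //; lia.
Qed.

(** * Exchange matrices *)

Section Quiver.
Variable Q : valued_cluster_quiver.

Lemma arrow_between_source_target (a : arrow Q) :
  arrow_between (source a) (target a) = Some a.
Proof.
rewrite /arrow_between; case: pickP => [b /andP[/eqP sb /eqP tb]|/(_ a)].
  by congr Some; apply: simple_arrow; rewrite sb tb.
by rewrite !eqxx.
Qed.

Lemma arrow_between_target_source (a : arrow Q) :
  arrow_between (target a) (source a) = None.
Proof.
rewrite /arrow_between; case: pickP => // b /andP[/eqP sb /eqP tb].
have ba : b = a by apply: simple_arrow; rewrite sb tb setUC.
by have := no_loop a; rewrite -{1}tb ba eqxx.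
Qed.

Lemma arrow_betweenP i j :
  match arrow_between i j with
  | Some a => i = source a /\ j = target a
  | None => forall a : arrow Q, ~ (source a = i /\ target a = j)
  end.
Proof.
rewrite /arrow_between; case: pickP => [a /andP[/eqP <- /eqP <-]|no_a] //.
by move=> a [ai aj]; have := no_a a; rewrite ai aj !eqxx.
Qed.

Lemma exchange_entry_skew (d : vertex Q -> nat) :
    (forall a, (d (source a) * Defs.val1 a)%N = (d (target a) * val2 a)%N) ->
  forall i j, (d i)%:Z * exchange_entry i j = - ((d j)%:Z * exchange_entry j i).
Proof.
move=> dE i j; rewrite /exchange_entry.
have := arrow_betweenP i j; case: arrow_between => [a [-> ->]|_].
  by rewrite arrow_between_target_source mulrN opprK -!PoszM dE.
have := arrow_betweenP j i; case: arrow_between => [a [-> ->]|_].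
  by rewrite mulrN -!PoszM dE.
by rewrite !mulr0 oppr0.
Qed.

End Quiver.

(** Fullness is what makes the exchange matrix of the subquiver a principal
    submatrix: no arrow of Q between two vertices of S is lost. *)
Lemma full_subquiver_entry (Q : valued_cluster_quiver) (S : {set vertex Q})
    (i j : vertex (full_subquiver S)) :
  exchange_entry i j = exchange_entry (val i) (val j).
Proof.
have eq_between (x y : vertex (full_subquiver S)) :
    omap val (arrow_between x y) = arrow_between (val x) (val y).
  have := arrow_betweenP _ x y; case: arrow_between => [a [-> ->]|no_a] /=.
    by rewrite -arrow_between_source_target.
  have := arrow_betweenP _ (val x) (val y); case: arrow_between => // a [xa ya].
  have aS : (source a \in S) && (target a \in S).
    by rewrite -xa -ya (valP x) (valP y).
  by case: (no_a (exist _ a aS)); split; apply: val_inj.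
rewrite /exchange_entry -!eq_between.
by case: arrow_between => //=; case: arrow_between.
Qed.

(** * Interlacing of the eigenvalues *)

Theorem theorem3p8 (R : realType) (Q : valued_cluster_quiver) (n : nat)
    (Q_card : #|vertex Q| = n)
    (S : {set vertex Q}) (S_card : #|S|.+1 = n)
    (lambda gamma : nat -> R)
    (lambda_eig : imaginary_eigenvalues (exchange_mx Q) 1 n lambda)
    (lambda_dec : nonincreasing_on 1 n lambda)
    (gamma_eig :
       imaginary_eigenvalues (exchange_mx (full_subquiver S)) 2 n gamma)
    (gamma_dec : nonincreasing_on 2 n gamma) :
  forall k, (1 <= k < n)%N ->
    gamma k.+1 <= lambda k /\ lambda k.+1 <= gamma k.+1.
Proof.
move=> k /andP[k_gt0 lt_kn].
have [d [d_gt0 dE]] := symmetrizable Q.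
pose Q' := full_subquiver S.
pose f (i : 'I_#|vertex Q'|) := enum_rank (val (enum_val i)).
have f_inj : injective f by move=> i j /enum_rank_inj/val_inj/enum_val_inj.
have sub_mx : exchange_mx Q' = mxsub f f (exchange_mx Q).
  by apply/matrixP=> i j; rewrite !mxE !enum_rankK full_subquiver_entry.
have card_Q' : #|vertex Q'| = n.-1 by rewrite card_sig -S_card.
have conj_i : ('i%C : R[i])^* = - 'i%C.
  by apply/eqP; rewrite eq_complex /= oppr0 !eqxx.
have i_neq0 : 'i%C != 0 :> R[i] by rewrite eq_complex /= oner_eq0 andbF.
have skew i j : (d (enum_val i))%:Z * exchange_mx Q i j =
    - ((d (enum_val j))%:Z * exchange_mx Q j i).
  by rewrite !mxE; apply: exchange_entry_skew.
have charE (p : nat) (u : nat -> R) (e : R) : e ^+ 2 = 1 ->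
    \prod_(p <= j < n.+1) ('X - ((u j)%:C%C * 'i%C)%:P) =
    \prod_(x <- [seq (e * u j)%:C%C | j <- index_iota p n.+1])
       ('X - ((e%:C%C * 'i%C) * x)%:P).
  move=> e2; rewrite big_map; apply: eq_bigr => j _; congr ('X - _%:P).
  by rewrite mulrAC -rmorphM mulrA -expr2 e2 mul1r.
(* The sign e = 1 gives the first family of inequalities, e = -1 the second. *)
have le (e a b : R) : e ^+ 2 = 1 ->
    (count (fun j => ~~ (e * lambda j <= a)%R) (index_iota 1 n.+1) +
     count (fun j => ~~ (b <= e * gamma j)%R) (index_iota 2 n.+1) < n.-1)%N ->
    b <= a.
  move=> e2 lt_n; rewrite -lecR.
  have e_neq0 : e != 0 by rewrite -sqrf_eq0 e2 oner_eq0.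
  apply: (skew_symmetrizable_le R[i] _ _ (exchange_mx Q)
    (fun i => d (enum_val i)) f (e%:C%C * 'i%C)
    [seq (e * lambda j)%:C%C | j <- index_iota 1 n.+1]
    [seq (e * gamma j)%:C%C | j <- index_iota 2 n.+1]) => //.
  - by rewrite mulf_neq0 // fmorph_eq0.
  - by rewrite rmorphM /= conj_i mulrN; congr (- (_ * _)); apply: conjc_real.
  - by rewrite -charE.
  - by rewrite -sub_mx -charE.
  rewrite card_Q' !count_map; apply: leq_ltn_trans lt_n.
  by rewrite leq_add // sub_count // => j /=; rewrite lecR.
split.
  apply: (le 1); first exact: expr1n.
  apply: (@leq_ltn_trans ((k - 1) + (n - k.+1))); last by lia.
  apply: leq_add; under eq_count => j do rewrite mul1r.
    by apply: (count_gt_nonincreasing _ _ _ _ _ lambda_dec); lia.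
  by apply: (count_lt_nonincreasing _ _ _ _ _ gamma_dec); lia.
rewrite -lerN2; apply: (le (-1)); first by rewrite sqrrN expr1n.
apply: (@leq_ltn_trans ((n - k.+1) + (k.+1 - 2))); last by lia.
apply: leq_add; under eq_count => j do rewrite mulN1r lerN2.
  by apply: (count_lt_nonincreasing _ _ _ _ _ lambda_dec); lia.
by apply: (count_gt_nonincreasing _ _ _ _ _ gamma_dec); lia.
Qed.
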